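(* Suppose $R=0$ and $f$ satisfies the Polyak–Łojasiewicz condition with constant $\mu>0$: $\|\nabla f(x)\|^2\ge2\mu(f(x)-f^\star)$ for all $x\in\mathbb{R}^d$, where $f^\star=f(x^\star)$ for a minimizer $x^\star$ of $f$. In EF-BV, suppose $\nu\in(0,1]$, $\lambda\in(0,1]$ is such that $r<1$, and $$0<\gamma\le\frac{1}{L+\tilde L\sqrt{\frac{r_{\mathrm{av}}}{r}}\frac{1}{s^\star}}.$$ For $t\ge0$ define $\Psi^t=f(x^t)-f^\star+\frac{\gamma}{2\theta^\star}\frac1n\sum_{i=1}^n\|\nabla f_i(x^t)-h_i^t\|^2$. Then for every $t\ge0$, $$\mathbb{E}[\Psi^t]\le\Big(\max\Big(1-\gamma\mu,\frac{r+1}{2}\Big)\Big)^t\Psi^0.$$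
   Context: Problem setting: $f=\frac1n\sum_{i=1}^nf_i$, where each $f_i:\mathbb{R}^d\to\mathbb{R}$ is convex and $L_i$-smooth (differentiable with $L_i$-Lipschitz gradient); $\tilde L=\sqrt{\frac1n\sum_iL_i^2}$ and $f$ is $L$-smooth with $L\le\tilde L$; $R:\mathbb{R}^d\to\mathbb{R}\cup\{+\infty\}$ is proper closed convex, $\mathrm{prox}_{\gamma R}(x)=\arg\min_y(\gamma R(y)+\frac12\|x-y\|^2)$, and a minimizer of $f+R$ exists. For $\eta\in[0,1)$, $\omega\ge0$, $\mathbb{C}(\eta,\omega)$ is the class of randomized operators $\mathcal{C}:\mathbb{R}^d\to\mathbb{R}^d$ with $\|\mathbb{E}[\mathcal{C}(x)]-x\|\le\eta\|x\|$ and $\mathbb{E}\|\mathcal{C}(x)-\mathbb{E}[\mathcal{C}(x)]\|^2\le\omega\|x\|^2$ for all $x$. Compressors $\mathcal{C}_i^t$ ($i=1,\dots,n$, $t\ge0$) all lie in $\mathbb{C}(\eta,\omega)$; those used at iteration $t$ are independent of all randomness of previous iterations; $\omega_{\mathrm{av}}\in[0,\omega]$ satisfies, for every $t$ and all $x_1,\dots,x_n$, $\mathbb{E}\|\frac1n\sum_i(\mathcal{C}_i^t(x_i)-\mathbb{E}[\mathcal{C}_i^t(x_i)])\|^2\le\frac{\omega_{\mathrm{av}}}{n}\sum_i\|x_i\|^2$. Algorithm EF-BV: given $x^0,h_1^0,\dots,h_n^0$, $\gamma>0$, $\lambda,\nu\in(0,1]$, $h^0=\frac1n\sum_ih_i^0$;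 for $t\ge0$: $d_i^t=\mathcal{C}_i^t(\nabla f_i(x^t)-h_i^t)$, $h_i^{t+1}=h_i^t+\lambda d_i^t$, $d^t=\frac1n\sum_id_i^t$, $h^{t+1}=h^t+\lambda d^t$, $g^{t+1}=h^t+\nu d^t$, $x^{t+1}=\mathrm{prox}_{\gamma R}(x^t-\gamma g^{t+1})$. Constants: $r=(1-\lambda+\lambda\eta)^2+\lambda^2\omega$, $r_{\mathrm{av}}=(1-\nu+\nu\eta)^2+\nu^2\omega_{\mathrm{av}}$, $s^\star=\sqrt{\frac{1+r}{2r}}-1$, $\theta^\star=s^\star(1+s^\star)\frac{r}{r_{\mathrm{av}}}$ (with $r>0$ and $r_{\mathrm{av}}>0$ so these are finite and positive). *)

(* Defs.v *)
From HB Require Import structures.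
From mathcomp Require Import all_boot all_order all_algebra.
From mathcomp Require Import all_classical all_reals all_analysis.
Set Implicit Arguments.
Unset Strict Implicit.
Unset Printing Implicit Defensive.
Import Order.TTheory GRing.Theory Num.Theory.
Import numFieldNormedType.Exports.
Local Open Scope ring_scope.

Section EFBV.
Variable R : realType.

Definition sqnorm (dim : nat) (v : 'rV[R]_dim) : R := \sum_(j < dim) (v 0 j) ^+ 2.

Definition enorm (dim : nat) (v : 'rV[R]_dim) : R := Num.sqrt (sqnorm v).

Definition grad (dim : nat) (f : 'rV[R]_dim -> R) (x : 'rV[R]_dim) : 'rV[R]_dim :=
  \row_(j < dim) ('D_(delta_mx 0 j) f x).

Definition convex_fun (dim : nat) (f : 'rV[R]_dim -> R) : Prop :=
  forall (x y : 'rV[R]_dim) (a : R), 0 <= a <= 1 ->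
    f (a *: x + (1 - a) *: y) <= a * f x + (1 - a) * f y.

Definition smooth (dim : nat) (f : 'rV[R]_dim -> R) (Lc : R) : Prop :=
  (forall x : 'rV[R]_dim, differentiable f x) /\
  (forall x y : 'rV[R]_dim, enorm (grad f x - grad f y) <= Lc * enorm (x - y)).

Definition favg (n dim : nat) (f : 'I_n -> 'rV[R]_dim -> R) (x : 'rV[R]_dim) : R :=
  (n%:R)^-1 * \sum_(i < n) f i x.

Variables (dd : measure_display) (Omega : measurableType dd) (P : probability Omega R).

Definition Evec (dim : nat) (F : Omega -> 'rV[R]_dim) : 'rV[R]_dim :=
  \row_(j < dim) fine (\int[P]_w (F w 0 j)%:E)%E.

(* The random operator C (realised as a function of the random seed w ~ P)
   belongs to the class C(eta, omega): its expectation exists and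
   ||E[C(x)] - x|| <= eta ||x||,  E||C(x) - E[C(x)]||^2 <= omega ||x||^2. *)
Definition in_class (dim : nat) (eta om : R) (C : Omega -> 'rV[R]_dim -> 'rV[R]_dim) : Prop :=
  forall x : 'rV[R]_dim,
    (forall j : 'I_dim, P.-integrable setT (fun w => (C w x 0 j)%:E)) /\
    enorm (Evec (fun w => C w x) - x) <= eta * enorm x /\
    (\int[P]_w (sqnorm (C w x - Evec (fun w => C w x)))%:E <= (om * sqnorm x)%:E)%E.

Definition omega_av_cond (n dim : nat) (omav : R)
    (C : 'I_n -> Omega -> 'rV[R]_dim -> 'rV[R]_dim) : Prop :=
  forall xs : 'I_n -> 'rV[R]_dim,
    (\int[P]_w (sqnorm ((n%:R)^-1 *:
        \sum_(i < n) (C i w (xs i) - Evec (fun w' => C i w' (xs i)))))%:E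
      <= ((omav / n%:R) * \sum_(i < n) sqnorm (xs i))%:E)%E.

(* ---------- the EF-BV algorithm with R = 0 (so prox_{gamma R} = id) ---------- *)

Record state (n dim : nat) := State {
  st_x : 'rV[R]_dim;
  st_h : 'I_n -> 'rV[R]_dim;
  st_hbar : 'rV[R]_dim }.

Definition efbv_step (n dim : nat) (f : 'I_n -> 'rV[R]_dim -> R)
    (C : nat -> 'I_n -> Omega -> 'rV[R]_dim -> 'rV[R]_dim)
    (gamma lam nu : R) (t : nat) (S : state n dim) (w : Omega) : state n dim :=
  let x := st_x S in
  let h := st_h S in
  let hb := st_hbar S in
  let d := fun i => C t i w (grad (f i) x - h i) in
  let dbar := (n%:R)^-1 *: \sum_(i < n) d i in
  let g := hb + nu *: dbar in
  State (x - gamma *: g) (fun i => h i + lam *: d i) (hb + lam *: dbar).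

(* Erun t0 k phi S = E[phi(state after k iterations)], starting from the
   deterministic state S at iteration index t0, each iteration using a fresh
   seed w_t ~ P independent of the past (iterated integral over the product
   of the seeds). *)
Fixpoint Erun (n dim : nat) (f : 'I_n -> 'rV[R]_dim -> R)
    (C : nat -> 'I_n -> Omega -> 'rV[R]_dim -> 'rV[R]_dim)
    (gamma lam nu : R) (t0 k : nat) (phi : state n dim -> \bar R)
    (S : state n dim) : \bar R :=
  match k with
  | 0 => phi S
  | k'.+1 => (\int[P]_w Erun f C gamma lam nu t0.+1 k' phi (efbv_step f C gamma lam nu t0 S w))%E
  end.

End EFBV.

Definition r_const (R : realType) (lam eta om : R) : R :=
  (1 - lam + lam * eta) ^+ 2 + lam ^+ 2 * om.
Definition s_star (R : realType) (r : R) : R :=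
  Num.sqrt ((1 + r) / (2 * r)) - 1.
Definition theta_star (R : realType) (r rav : R) : R :=
  s_star r * (1 + s_star r) * (r / rav).

Definition Psi (R : realType) (n dim : nat) (f : 'I_n -> 'rV[R]_dim -> R)
    (fstar gamma theta : R) (S : state R n dim) : R :=
  favg f (st_x S) - fstar
  + gamma / (2 * theta) * ((n%:R)^-1 * \sum_(i < n) sqnorm (grad (f i) (st_x S) - st_h S i)).

(* Main.v *)
Require Import Defs.
From HB Require Import structures.
From mathcomp Require Import all_boot all_order all_algebra.
From mathcomp Require Import all_classical all_reals all_analysis.
From mathcomp Require Import ring lra measurable_realfun.
Import Order.TTheory GRing.Theory Num.Theory.
Import numFieldNormedType.Exports.
Local Open Scope ring_scope.

(* One step of the algorithm is bounded pointwise, for every value of the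
   compressor outputs d_i: the descent lemma for f, together with
   -2 <grad f, g> = |grad f - g|^2 - |grad f|^2 - |g|^2 and the PL inequality,
   controls f(x^{t+1}), while Young's inequality with parameter s^* controls
   the shift errors.  The stepsize condition makes the coefficient of |g|^2
   nonpositive.  What remains is quadratic in the d_i, and the bias-variance
   decomposition bounds its expectation: the estimator error contributes r_av
   and the shift errors contribute r, with
   theta^* r_av + (1 + s^* ) r = (1 + s^* )^2 r = (1 + r) / 2. *)

(** * Euclidean inner product and norm on row vectors *)

Section Euclidean.
Context {R : realType} {dim : nat}.
Implicit Types (u v w : 'rV[R]_dim) (a : R).

Definition vdot u v : R := \sum_(j < dim) u 0 j * v 0 j.

Lemma vdotC u v : vdot u v = vdot v u.
Proof. by apply: eq_bigr => j _; rewrite mulrC. Qed.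

Lemma vdotDl u v w : vdot (u + v) w = vdot u w + vdot v w.
Proof. by rewrite -big_split; apply: eq_bigr => j _; rewrite mxE mulrDl. Qed.

Lemma vdotZl a u v : vdot (a *: u) v = a * vdot u v.
Proof. by rewrite mulr_sumr; apply: eq_bigr => j _; rewrite mxE mulrA. Qed.

Lemma vdotNl u v : vdot (- u) v = - vdot u v.
Proof. by rewrite -scaleN1r vdotZl mulN1r. Qed.

Lemma vdotBl u v w : vdot (u - v) w = vdot u w - vdot v w.
Proof. by rewrite vdotDl vdotNl. Qed.

Lemma vdotZr a u v : vdot u (a *: v) = a * vdot u v.
Proof. by rewrite vdotC vdotZl vdotC. Qed.

Lemma vdot_suml (I : finType) (F : I -> 'rV[R]_dim) w :
  vdot (\sum_i F i) w = \sum_i vdot (F i) w.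
Proof.
by rewrite exchange_big; apply: eq_bigr => j _; rewrite summxE mulr_suml.
Qed.

Lemma sqnorm_ge0 u : 0 <= sqnorm u.
Proof. by apply: sumr_ge0 => j _; exact: sqr_ge0. Qed.

Lemma sqnorm_eq0 {u} : sqnorm u = 0 -> u = 0.
Proof.
move=> /eqP; rewrite psumr_eq0 => [/allP u0|j _]; last exact: sqr_ge0.
apply/rowP => j; have := u0 j (mem_index_enum j).
by rewrite /= sqrf_eq0 mxE => /eqP.
Qed.

Lemma sqnormZ a u : sqnorm (a *: u) = a ^+ 2 * sqnorm u.
Proof. by rewrite mulr_sumr; apply: eq_bigr => j _; rewrite mxE exprMn. Qed.

Lemma sqnormN u : sqnorm (- u) = sqnorm u.
Proof. by rewrite -scaleN1r sqnormZ sqrrN expr1n mul1r. Qed.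

Lemma sqnormD u v : sqnorm (u + v) = sqnorm u + 2 * vdot u v + sqnorm v.
Proof.
rewrite mulr_sumr -!big_split; apply: eq_bigr => j _ /=.
by rewrite mxE; ring.
Qed.

Lemma sqnormB u v : sqnorm (u - v) = sqnorm u - 2 * vdot u v + sqnorm v.
Proof. by rewrite sqnormD sqnormN (vdotC u) vdotNl mulrN vdotC. Qed.

Lemma vdotvv u : vdot u u = sqnorm u.
Proof. by []. Qed.

Lemma sqr_enorm u : enorm u ^+ 2 = sqnorm u.
Proof. by rewrite sqr_sqrtr ?sqnorm_ge0. Qed.

Lemma enorm_ge0 u : 0 <= enorm u.
Proof. exact: sqrtr_ge0. Qed.

(** The two sides differ by the square [s^-1 * sqnorm (s *: u - v)]. *)
Lemma sqnorm_young {s : R} u v : 0 < s ->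
  sqnorm (u + v) <= (1 + s) * sqnorm u + (1 + s^-1) * sqnorm v.
Proof.
move=> s0; rewrite -subr_ge0.
suff -> : (1 + s) * sqnorm u + (1 + s^-1) * sqnorm v - sqnorm (u + v)
    = s^-1 * sqnorm (s *: u - v).
  by rewrite mulr_ge0 ?sqnorm_ge0 // invr_ge0 ltW.
rewrite sqnormB sqnormZ vdotZl sqnormD; field; exact: lt0r_neq0.
Qed.

(** Cauchy-Schwarz, from expanding the square of [enorm v *: u - enorm u *: v]. Cancelling the
    factor [enorm u * enorm v] requires it to be positive, so zero vectors are treated first. *)
Lemma vdot_le_enorm u v : vdot u v <= enorm u * enorm v.
Proof.
have [u0|u0] := eqVneq (sqnorm u) 0.
  by rewrite /enorm u0 sqrtr0 mul0r (sqnorm_eq0 u0) -(scale0r (0 : 'rV[R]_dim)) vdotZl mul0r.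
have [v0|v0] := eqVneq (sqnorm v) 0.
  rewrite [X in _ * X]/enorm v0 sqrtr0 mulr0 (sqnorm_eq0 v0).
  by rewrite -(scale0r (0 : 'rV[R]_dim)) vdotZr mul0r.
have ab0 : 0 < enorm u * enorm v.
  by rewrite mulr_gt0 // sqrtr_gt0 lt_def ?u0 ?v0 sqnorm_ge0.
have := sqnorm_ge0 (enorm v *: u - enorm u *: v).
rewrite sqnormB !sqnormZ vdotZl vdotZr -!sqr_enorm.
rewrite (_ : _ + _ = (enorm u * enorm v * (enorm u * enorm v - vdot u v)) * 2); last by ring.
by rewrite pmulr_lge0 // pmulr_rge0 // subr_ge0.
Qed.

Lemma enorm_triangle u v : enorm (u + v) <= enorm u + enorm v.
Proof.
rewrite -(@ler_pXn2r _ 2) ?nnegrE ?addr_ge0 ?enorm_ge0 //.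
rewrite sqr_enorm sqnormD -!sqr_enorm.
have := vdot_le_enorm u v; nra.
Qed.

Lemma enormZ a u : enorm (a *: u) = `|a| * enorm u.
Proof. by rewrite /enorm sqnormZ sqrtrM ?sqr_ge0 // sqrtr_sqr. Qed.

Lemma enormN u : enorm (- u) = enorm u.
Proof. by rewrite /enorm sqnormN. Qed.

End Euclidean.

(** Jensen's inequality for the square: the deviations from the mean [m] have nonnegative total
    square, and their cross terms sum to a multiple of [sqnorm m]. *)
Lemma sqnorm_avg_le {R : realType} {n dim : nat} (u : 'I_n -> 'rV[R]_dim) :
  (0 < n)%N ->
  sqnorm (n%:R^-1 *: \sum_i u i) <= n%:R^-1 * \sum_i sqnorm (u i).
Proof.
move=> n0; have nR : 0 < n%:R :> R by rewrite ltr0n.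
set m := n%:R^-1 *: _.
have sm : \sum_i u i = n%:R *: m by rewrite scalerA divff ?gt_eqF // scale1r.
have : 0 <= \sum_i sqnorm (u i - m) by apply: sumr_ge0 => i _; exact: sqnorm_ge0.
under eq_bigr do rewrite sqnormB.
rewrite !big_split /= sumr_const card_ord sumrN -mulr_sumr -vdot_suml sm.
rewrite vdotZl vdotvv -mulr_natl ler_pdivlMl // => h.
lra.
Qed.

(** * Gradients along lines and the descent lemma *)

Lemma derive_grad {R : realType} {dim : nat} (f : 'rV[R]_dim -> R) x v :
  differentiable f x -> 'D_v f x = vdot (grad f x) v.
Proof.
move=> df; rewrite deriveE // {1}(row_sum_delta v) linear_sum.
by apply: eq_bigr => j _; rewrite linearZ mxE deriveE //= mulrC.
Qed.

Lemma is_derive_line {R : realType} {dim : nat} (f : 'rV[R]_dim -> R) x v (t : R) :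
  differentiable f (x + t *: v) ->
  is_derive t 1 (fun t' : R => f (x + t' *: v)) (vdot (grad f (x + t *: v)) v).
Proof.
move=> df; rewrite -derive_grad //.
(* The difference quotient of the restriction to the line is the quotient of [f] at [x + t *: v] in
   direction [v], so derivability and the value both transfer. *)
have E : (fun h : R => h^-1 *: (((fun t' : R => f (x + t' *: v)) \o shift t) (h *: 1)
            - f (x + t *: v)))
       = (fun h : R => h^-1 *: ((f \o shift (x + t *: v)) (h *: v) - f (x + t *: v))).
  apply/funext => h /=; congr (_ *: (f _ - _)).
  by rewrite [h *: 1]mulr1 scalerDl addrCA.
apply: DeriveDef; last by rewrite /derive E.
by rewrite /derivable E; exact: diff_derivable.
Qed.

Lemma is_derive_quadratic {R : realType} (a b t : R) :
  is_derive t 1 (fun t' : R => t' * a + t' ^+ 2 * b) (a + 2 * t * b).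
Proof.
apply: is_derive_eq.
by rewrite /GRing.scale /=; ring.
Qed.

(** Subtracting the linear and quadratic terms along the segment leaves a function [p] whose
    derivative is nonpositive for positive times, by Cauchy-Schwarz and the Lipschitz bound. The
    mean value theorem then gives [p 1 <= p 0], which is the claim. *)
Lemma descent {R : realType} {dim : nat} {f : 'rV[R]_dim -> R} {L : R} x y :
  smooth f L ->
  f y <= f x + vdot (grad f x) (y - x) + L / 2 * sqnorm (y - x).
Proof.
move=> [df lip]; set v := y - x.
pose p (t : R) := f (x + t *: v) -
  (t * vdot (grad f x) v + t ^+ 2 * (L / 2 * sqnorm v)).
pose dp (t : R) := vdot (grad f (x + t *: v) - grad f x) v - t * (L * sqnorm v).
have pd (t : R) : is_derive t 1 p (dp t).
  have h := is_deriveB (is_derive_line f x v t (df _))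
    (is_derive_quadratic (vdot (grad f x) v) (L / 2 * sqnorm v) t).
  apply: is_derive_eq h _.
  by rewrite /dp vdotBl; field.
have cp : {within `[0, 1], continuous p}%classic.
  by apply: derivable_within_continuous => t _; have [] := pd t.
have [c] := MVT ltr01 (fun t _ => pd t) cp.
rewrite in_itv /= => /andP[c0 c1]; rewrite subr0 mulr1 /p.
rewrite scale1r scale0r addr0 !mul0r expr0n mul0r expr1n !mul1r addr0 subr0.
have -> : x + v = y by rewrite /v addrC subrK.
suff : dp c <= 0 by move=> h e; lra.
rewrite /dp subr_le0; apply: le_trans (vdot_le_enorm _ _) _.
apply: le_trans (ler_wpM2r (enorm_ge0 _) (lip _ _)) _.
rewrite [x + _]addrC addrK enormZ gtr0_norm // -sqr_enorm le_eqVlt; apply/orP; left; apply/eqP; ring.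
Qed.

Lemma grad_favg {R : realType} {n dim : nat} (f : 'I_n -> 'rV[R]_dim -> R) x :
  (forall i, differentiable (f i) x) ->
  grad (favg f) x = n%:R^-1 *: \sum_i grad (f i) x.
Proof.
move=> df; apply/rowP => j; rewrite !mxE summxE.
have -> : favg f = n%:R^-1 \*: (\sum_i f i).
  by apply/funext => y; rewrite /favg /= fct_sumE.
rewrite deriveZ; last exact: derivable_sum (fun i => diff_derivable (df i)).
rewrite derive_sum; last by move=> i; exact: diff_derivable.
by congr (_ *: _); apply: eq_bigr => i _; rewrite mxE.
Qed.

(* No measurability is needed, because the integral of a nonnegative function
   is a supremum over simple functions below it.  This matters because the
   compressors are not assumed measurable in their vector argument, so that
   iterated expectations may have nonmeasurable integrands. *)
Lemma le_integral_nonneg {d} {T : measurableType d} {R : realType}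
    (mu : {measure set T -> \bar R}) (f g : T -> \bar R) :
  (forall x, (0 <= f x)%E) -> (forall x, (f x <= g x)%E) ->
  (\int[mu]_x f x <= \int[mu]_x g x)%E.
Proof.
move=> f0 fg; have g0 x : (0 <= g x)%E by exact: le_trans (f0 x) (fg x).
rewrite !ge0_integralTE //; apply: le_ereal_sup => _ [h hf <-].
by exists h => // x; exact: le_trans (hf x) (fg x).
Qed.

(** * Expectations of random vectors and the bias-variance bound *)

Section Expectation.
Context {R : realType} {dd : measure_display} {Omega : measurableType dd}.
Variable P : probability Omega R.

Lemma Rintegral_probability_cst (c : R) : \int[P]_w c = c.
Proof. by rewrite Rintegral_cst //= probability_setT mulr1. Qed.

Lemma integrable_probability_cst (c : R) : P.-integrable setT (EFin \o (fun=> c)).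
Proof. exact: finite_measure_integrable_cst. Qed.

Lemma integrable_lincomb {I : finType} (a : I -> R) (F : I -> Omega -> R) :
  (forall i, P.-integrable setT (EFin \o F i)) ->
  P.-integrable setT (EFin \o (fun w => \sum_i a i * F i w)).
Proof.
move=> iF.
have -> : EFin \o (fun w => \sum_i a i * F i w)
    = (fun w => \sum_i ((a i)%:E * (F i w)%:E))%E.
  by apply/funext => w /=; rewrite -sumEFin.
by apply: integrable_sum => // i _; apply: integrableZl => //; exact: iF.
Qed.

Lemma Rintegral_lincomb {I : finType} (a : I -> R) (F : I -> Omega -> R) :
  (forall i, P.-integrable setT (EFin \o F i)) ->
  \int[P]_w (\sum_i a i * F i w) = \sum_i a i * \int[P]_w F i w.
Proof.
move=> iF; apply: EFin_inj; rewrite -sumEFin /Rintegral fineK; last first.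
  exact: integrable_fin_num (integrable_lincomb a F iF).
under eq_integral do rewrite -sumEFin.
under eq_integral do under eq_bigr do rewrite EFinM.
rewrite integral_sum //; last by move=> i; apply: integrableZl => //; exact: iF.
apply: eq_bigr => i _; rewrite integralZl //; last exact: iF.
by rewrite EFinM fineK //; exact: integrable_fin_num (iF i).
Qed.

Section Vector.
Context {dim : nat} {X : Omega -> 'rV[R]_dim}.
Hypothesis intX : forall j, P.-integrable setT (fun w => (X w 0 j)%:E).

Lemma integrable_vdot b : P.-integrable setT (EFin \o (fun w => vdot b (X w))).
Proof. exact: integrable_lincomb (fun j => b 0 j) (fun j w => X w 0 j) intX. Qed.

Lemma Rintegral_vdot b : \int[P]_w vdot b (X w) = vdot b (Evec P X).
Proof.
rewrite /vdot (Rintegral_lincomb (fun j => b 0 j) (fun j w => X w 0 j) intX).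
by apply: eq_bigr => j _; rewrite mxE.
Qed.

Lemma measurable_sqnormB b : measurable_fun setT (fun w => sqnorm (X w - b)).
Proof.
rewrite /sqnorm; apply: measurable_sum => j.
under eq_fun do rewrite !mxE expr2.
have mX : measurable_fun setT (fun w => X w 0 j - b 0 j).
  apply: measurable_funB => //.
  by have /measurable_int/measurable_EFinP := intX j.
exact: (measurable_funM mX mX).
Qed.

Context {V : R}.
Hypothesis varX : (\int[P]_w (sqnorm (X w - Evec P X))%:E <= V%:E)%E.

Lemma integrable_variance :
  P.-integrable setT (EFin \o (fun w => sqnorm (X w - Evec P X))).
Proof.
apply/integrableP; split.
  by apply/measurable_EFinP; exact: measurable_sqnormB.
under eq_integral do rewrite /= ger0_norm ?sqnorm_ge0 //.
exact: le_lt_trans varX (ltry _).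
Qed.

(** Splits the square into a constant, a multiple of the squared deviation and a term linear in
    [X w], each integrable under the hypotheses of the section. The second constant is minus the
    mean of the linear term. *)
Lemma sqnorm_affine_decomp a (c : R) w :
  sqnorm (a - c *: X w) =
    (sqnorm (a - c *: Evec P X) + 2 * c * vdot (a - c *: Evec P X) (Evec P X))
    + c ^+ 2 * sqnorm (X w - Evec P X)
    + vdot ((- 2 * c) *: (a - c *: Evec P X)) (X w).
Proof.
set m := Evec P X.
have -> : a - c *: X w = (a - c *: m) - c *: (X w - m).
  by rewrite scalerBr opprB addrA subrK.
rewrite (sqnormB (a - c *: m)) sqnormZ vdotZr vdotC vdotBl vdotZl.
rewrite (vdotC (X w)) (vdotC m); ring.
Qed.

Lemma integrable_sqnorm_affine a (c : R) :
  P.-integrable setT (EFin \o (fun w => sqnorm (a - c *: X w))).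
Proof.
rewrite (funext (sqnorm_affine_decomp a c)).
apply: (@integrableD _ _ _ P setT measurableT
  (EFin \o (fun w => _ + _ * sqnorm (X w - _))) (EFin \o (fun w => vdot _ (X w)))).
  apply: (@integrableD _ _ _ P setT measurableT
    (EFin \o (fun=> _)) (EFin \o (fun w => _ * sqnorm (X w - _)))).
    exact: integrable_probability_cst.
  exact: integrableZl measurableT _ _ integrable_variance.
exact: integrable_vdot.
Qed.

(** After integration the linear term cancels against the constant that compensates it. Only the
    squared bias and the variance, bounded by [V], remain. *)
Lemma bias_variance_le a (c : R) :
  \int[P]_w sqnorm (a - c *: X w) <= sqnorm (a - c *: Evec P X) + c ^+ 2 * V.
Proof.
rewrite (funext (sqnorm_affine_decomp a c)).
have iv : P.-integrable setT (EFin \o (fun w => c ^+ 2 * sqnorm (X w - Evec P X))).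
  exact: integrableZl measurableT _ _ integrable_variance.
rewrite RintegralD //; last 2 first.
  exact: (@integrableD _ _ _ P setT measurableT
    (EFin \o (fun=> _)) _ (integrable_probability_cst _) iv).
  exact: integrable_vdot.
rewrite RintegralD //; last exact: integrable_probability_cst.
rewrite Rintegral_probability_cst Rintegral_vdot RintegralZl //; last first.
  exact: integrable_variance.
have : \int[P]_w sqnorm (X w - Evec P X) <= V.
  by rewrite -lee_fin /Rintegral fineK // (integrable_fin_num _ integrable_variance).
rewrite vdotZl => /(ler_wpM2l (sqr_ge0 c)); lra.
Qed.

End Vector.

Lemma Evec_lincomb {n dim : nat} (a : R) (X : 'I_n -> Omega -> 'rV[R]_dim) :
  (forall i j, P.-integrable setT (fun w => (X i w 0 j)%:E)) ->
  Evec P (fun w => a *: \sum_i X i w) = a *: \sum_i Evec P (X i).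
Proof.
move=> iX; apply/rowP => j; rewrite !mxE summxE mulr_sumr.
under eq_integral do rewrite mxE summxE mulr_sumr.
rewrite -[LHS]/(\int[P]_w (\sum_i a * X i w 0 j)).
rewrite (Rintegral_lincomb (fun=> a) (fun i w => X i w 0 j)) => [|i]; last exact: iX.
by apply: eq_bigr => i _; rewrite mxE.
Qed.

End Expectation.

(* A negative smoothness constant is possible only in dimension 0. *)
Lemma smooth_neg {R : realType} {dim : nat} {f : 'rV[R]_dim -> R} {L : R} :
  smooth f L -> L < 0 -> forall v : 'rV[R]_dim, sqnorm v = 0.
Proof.
move=> [_ lip] L0 v; have := le_trans (enorm_ge0 _) (lip v 0).
rewrite subr0 nmulr_rge0 // => v0.
have {}v0 : enorm v = 0 by apply/eqP; rewrite eq_le v0 enorm_ge0.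
by rewrite -sqr_enorm v0 expr0n.
Qed.

(** Squaring the Lipschitz bound needs a nonnegative right side; the bound itself provides this,
    since its left side is a norm. *)
Lemma sqnorm_grad_sub {R : realType} {dim : nat} {f : 'rV[R]_dim -> R} {L : R} x y :
  smooth f L -> sqnorm (grad f x - grad f y) <= L ^+ 2 * sqnorm (x - y).
Proof.
move=> [_ lip]; rewrite -!sqr_enorm -exprMn ler_pXn2r ?nnegrE ?enorm_ge0 //.
exact: le_trans (enorm_ge0 _) (lip x y).
Qed.

(** Writing [x - c *: m] as [(1 - c) *: x - c *: (m - x)] separates damping from bias. With [m] the
    mean compressor output this yields the first summand of [r_const]. *)
Lemma sqnorm_bias {R : realType} {dim : nat} (eta c : R) (m x : 'rV[R]_dim) :
  0 <= eta -> 0 < c <= 1 -> enorm (m - x) <= eta * enorm x ->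
  sqnorm (x - c *: m) <= (1 - c + c * eta) ^+ 2 * sqnorm x.
Proof.
move=> eta0 /andP[c0 c1] hm.
have k0 : 0 <= 1 - c + c * eta by rewrite addr_ge0 ?subr_ge0 // mulr_ge0 // ltW.
rewrite -!sqr_enorm -exprMn ler_pXn2r ?nnegrE ?mulr_ge0 ?enorm_ge0 //.
have -> : x - c *: m = (1 - c) *: x - c *: (m - x).
  by rewrite scalerBr scalerBl scale1r opprB addrA subrK.
apply: le_trans (enorm_triangle _ _) _.
rewrite enormN !enormZ ger0_norm ?subr_ge0 // gtr0_norm //.
have := ler_wpM2l (ltW c0) hm; lra.
Qed.

(** * The constants of the rate and the stepsize condition *)

Section Constants.
Context {R : realType} {r rav : R}.
Hypotheses (r0 : 0 < r) (r1 : r < 1) (rav0 : 0 < rav).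

Lemma s_star_gt0 : 0 < s_star r.
Proof.
rewrite subr_gt0 -[X in X < _]sqrtr1 ltr_sqrt; last first.
  by rewrite divr_gt0 ?mulr_gt0 ?addr_gt0.
rewrite ltr_pdivlMr ?mulr_gt0 //; move: r1; lra.
Qed.

(** This identity is the reason for the choice of [s_star]: the contraction factor of the shift
    errors ends up halfway between [r] and 1. *)
Lemma sqr_s_star : (1 + s_star r) ^+ 2 * r = (1 + r) / 2.
Proof.
rewrite /s_star addrC subrK sqr_sqrtr; last first.
  by rewrite divr_ge0 ?mulr_ge0 ?addr_ge0 // ltW.
field; exact: lt0r_neq0.
Qed.

Lemma theta_star_gt0 : 0 < theta_star r rav.
Proof.
rewrite /theta_star; move: (s_star r) s_star_gt0 => s s0.
by rewrite !mulr_gt0 ?addr_gt0 ?invr_gt0.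
Qed.

Lemma theta_star_eq : theta_star r rav * rav + (1 + s_star r) * r = (1 + r) / 2.
Proof. by rewrite -sqr_s_star /theta_star; field; exact: lt0r_neq0. Qed.

(** By the choice of [theta_star] the second summand is exactly [(gamma * b) ^+ 2]. The stepsize
    bound says [gamma * L + gamma * b <= 1], so [gamma * b] lies in the unit interval and dominates
    its square. *)
Lemma stepsize_cond {L M gamma : R} :
  0 <= M -> 0 <= L -> 0 < gamma ->
  gamma <= (L + Num.sqrt M * Num.sqrt (rav / r) * (s_star r)^-1)^-1 ->
  gamma * L + gamma ^+ 2 / theta_star r rav * (1 + (s_star r)^-1) * M <= 1.
Proof.
move=> M0 L0 g0; have s0 := s_star_gt0.
set b := _ * _ * _ => hg.
have b0 : 0 <= b by rewrite !mulr_ge0 ?sqrtr_ge0 // invr_ge0 ltW.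
(* The inverse of [L + b] is at least [gamma], hence positive, so [L + b] is too. *)
have Lb0 : 0 < L + b by rewrite -invr_gt0 (lt_le_trans g0).
have {}hg : gamma * L + gamma * b <= 1.
  by rewrite -mulrDr -ler_pdivlMr // mul1r.
have -> : gamma ^+ 2 / theta_star r rav * (1 + (s_star r)^-1) * M = (gamma * b) ^+ 2.
  rewrite /b !exprMn !sqr_sqrtr //; last by rewrite divr_ge0 // ltW.
  rewrite /theta_star; field.
  by rewrite !lt0r_neq0 // addr_gt0.
have gL0 : 0 <= gamma * L by rewrite mulr_ge0 // ltW.
have gb0 : 0 <= gamma * b by rewrite mulr_ge0 // ltW.
have gb1 : gamma * b <= 1 by lra.
nra.
Qed.

End Constants.

(** * The algorithm and iteration of a one-step contraction *)

Section Algorithm.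
Context {R : realType} {n dim : nat} (f : 'I_n -> 'rV[R]_dim -> R).

(** The state stores the averaged shift as a separate field; this is the invariant tying it to the
    individual shifts. *)
Definition hbar_consistent (S : state R n dim) :=
  st_hbar S = n%:R^-1 *: \sum_i st_h S i.

Lemma Psi_ge0 fstar gamma theta S :
  (forall x, fstar <= favg f x) -> 0 < gamma -> 0 < theta ->
  0 <= Psi f fstar gamma theta S.
Proof.
move=> hmin g0 t0; rewrite addr_ge0 ?subr_ge0 //.
rewrite mulr_ge0 ?divr_ge0 ?mulr_ge0 ?invr_ge0 ?(ltW g0) ?(ltW t0) //.
by apply: sumr_ge0 => i _; exact: sqnorm_ge0.
Qed.

Context {dd : measure_display} {Omega : measurableType dd}.
Variables (P : probability Omega R).
Variables (C : nat -> 'I_n -> Omega -> 'rV[R]_dim -> 'rV[R]_dim).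
Variables (gamma lam nu : R).

Lemma efbv_step_consistent t S w :
  hbar_consistent S -> hbar_consistent (efbv_step f C gamma lam nu t S w).
Proof.
rewrite /hbar_consistent /= => ->.
by rewrite big_split -scaler_sumr scalerDr !scalerA mulrC.
Qed.

(** The one-step hypothesis goes through an integrable majorant [U] because [phi] after a step may
    be nonmeasurable in the seed. [Erun] integrates the first seed outermost, so the induction must
    hold for every starting index and state. *)
Lemma Erun_contraction (phi : state R n dim -> R) (rho : R) :
  (forall S, 0 <= phi S) -> 0 <= rho ->
  (forall t S, hbar_consistent S -> exists U : Omega -> R,
    [/\ P.-integrable setT (EFin \o U),
        forall w, phi (efbv_step f C gamma lam nu t S w) <= U w
      & \int[P]_w U w <= rho * phi S]) ->
  forall k t S, hbar_consistent S ->
    (Erun P f C gamma lam nu t k (fun S => (phi S)%:E) S <= (rho ^+ k * phi S)%:E)%E.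
Proof.
move=> phi0 rho0 step.
have Erun0 k t S : (0 <= Erun P f C gamma lam nu t k (fun S => (phi S)%:E) S)%E.
  by elim: k t S => [|k IH] t S /=; [rewrite lee_fin | exact: integral_ge0].
elim=> [|k IH] t S hS /=; first by rewrite expr0 mul1r.
have [U [iU hU intU]] := step t S hS.
(* The induction hypothesis from the state after one step, followed by the majorant, bounds the
   inner expectation by an integrable function. *)
apply: (@le_trans _ _ (\int[P]_w ((rho ^+ k)%:E * (U w)%:E))%E).
  apply: le_integral_nonneg => // w.
  apply: le_trans (IH _ _ (efbv_step_consistent _ _ _ hS)) _.
  by rewrite -EFinM lee_fin ler_wpM2l // exprn_ge0.
rewrite integralZl // exprSr -mulrA -[X in (_ * X)%E]fineK; last first.
  exact: integrable_fin_num iU.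
by rewrite -EFinM lee_fin ler_wpM2l // exprn_ge0.
Qed.

(** * Pointwise bound on one iteration *)

Section Step.
Variables (Ls : 'I_n -> R) (L mu fstar s theta : R).
Hypothesis n_gt0 : (0 < n)%N.
Hypothesis fi_smooth : forall i, smooth (f i) (Ls i).
Hypothesis f_smooth : smooth (favg f) L.
Hypothesis f_PL :
  forall x, 2 * mu * (favg f x - fstar) <= sqnorm (grad (favg f) x).
Hypotheses (gamma_gt0 : 0 < gamma) (s_gt0 : 0 < s) (theta_gt0 : 0 < theta).
Hypothesis stepsize : 0 <= L ->
  gamma * L + gamma ^+ 2 / theta * (1 + s^-1) * (n%:R^-1 * \sum_i Ls i ^+ 2) <= 1.

Definition shift_err (S : state R n dim) i := grad (f i) (st_x S) - st_h S i.

(** In this bound the gradients at the new iterate are gone: the seed enters only through squares of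
    affine functions of the compressor outputs, which can be integrated. *)
Definition Psi_majorant t (S : state R n dim) w :=
  (1 - gamma * mu) * (favg f (st_x S) - fstar)
  + gamma / 2 * sqnorm (n%:R^-1 *: \sum_i shift_err S i
                        - nu *: (n%:R^-1 *: \sum_i C t i w (shift_err S i)))
  + gamma / (2 * theta) * (1 + s)
    * (n%:R^-1 * \sum_i sqnorm (shift_err S i - lam *: C t i w (shift_err S i))).

Lemma Psi_step_le t S w : hbar_consistent S ->
  Psi f fstar gamma theta (efbv_step f C gamma lam nu t S w) <= Psi_majorant t S w.
Proof.
case: S => x h hb; rewrite /hbar_consistent /Psi_majorant /Psi /shift_err /= => ->.
set e := fun i => grad (f i) x - h i.
set d := fun i => C t i w (e i).
rewrite -/(e _) -/(d _).
set hbar := n%:R^-1 *: \sum_i h i.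
set D := n%:R^-1 *: \sum_i d i.
set ebar := n%:R^-1 *: \sum_i e i.
set g := hbar + nu *: D.
have nR0 : 0 <= n%:R^-1 :> R by rewrite invr_ge0.
(* Consistency of the averaged shift enters here: the gradient and [g] share the summand [hbar], so
   their difference is [ebar - nu *: D]. *)
have gradE : grad (favg f) x = hbar + ebar.
  rewrite grad_favg => [|i]; last by have [] := fi_smooth i.
  by rewrite -scalerDr -big_split; congr (_ *: _); apply: eq_bigr => i _; rewrite /= addrC subrK.
have xE : x - gamma *: g - x = - (gamma *: g) by rewrite addrAC subrr add0r.
have := descent x (x - gamma *: g) f_smooth.
rewrite xE sqnormN sqnormZ (vdotC _ (- _)) vdotNl vdotZl => hdesc.
have hB : sqnorm (ebar - nu *: D) = sqnorm (grad (favg f) x) - 2 * vdot g (grad (favg f) x) + sqnorm g.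
  rewrite vdotC -sqnormB gradE /g; congr sqnorm.
  by rewrite opprD addrACA subrr add0r.
(* Young's inequality for each worker separates the compression error from the gradient drift, and
   smoothness bounds the drift by the step length [gamma ^+ 2 * sqnorm g]. *)
have hG : n%:R^-1 * \sum_i sqnorm (grad (f i) (x - gamma *: g) - (h i + lam *: d i))
    <= (1 + s) * (n%:R^-1 * \sum_i sqnorm (e i - lam *: d i))
       + (1 + s^-1) * (n%:R^-1 * \sum_i Ls i ^+ 2) * (gamma ^+ 2 * sqnorm g).
  have -> : (1 + s) * (n%:R^-1 * \sum_i sqnorm (e i - lam *: d i))
      + (1 + s^-1) * (n%:R^-1 * \sum_i Ls i ^+ 2) * (gamma ^+ 2 * sqnorm g)
    = n%:R^-1 * \sum_i ((1 + s) * sqnorm (e i - lam *: d i)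
        + (1 + s^-1) * (Ls i ^+ 2 * (gamma ^+ 2 * sqnorm g))).
    rewrite big_split -!mulr_sumr -mulr_suml /=; ring.
  rewrite ler_wpM2l //; apply: ler_sum => i _.
  have -> : grad (f i) (x - gamma *: g) - (h i + lam *: d i)
     = (e i - lam *: d i) + (grad (f i) (x - gamma *: g) - grad (f i) x).
    by rewrite opprD [RHS]addrC /e -[X in _ = _ + X]addrA subrKA.
  apply: le_trans (sqnorm_young _ _ s_gt0) _.
  rewrite lerD2l ler_wpM2l ?addr_ge0 ?invr_ge0 ?(ltW s_gt0) //.
  apply: le_trans (sqnorm_grad_sub _ _ (fi_smooth i)) _.
  by rewrite xE sqnormN sqnormZ.
have hPL := f_PL x.
have hst := stepsize.
set M := n%:R^-1 * \sum_i Ls i ^+ 2 in hG hst.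
(* The stepsize condition is available only for nonnegative [L]; otherwise all norms vanish and so
   does the product. *)
have hstep : 0 <= (1 - (gamma * L + gamma ^+ 2 / theta * (1 + s^-1) * M)) * sqnorm g.
  have [L0|L0] := leP 0 L; last by rewrite (smooth_neg f_smooth L0) mulr0.
  by rewrite mulr_ge0 ?sqnorm_ge0 // subr_ge0 hst.
have k0 : 0 <= gamma / (2 * theta) by rewrite divr_ge0 ?mulr_ge0 ?ltW.
have {hG} := ler_wpM2l k0 hG.
have {hstep} := mulr_ge0 (ltW gamma_gt0) hstep.
have {hPL} := ler_wpM2l (ltW gamma_gt0) hPL.
(* With every quotient by [theta] expressed through [gamma / (2 * theta)], the goal is a linear
   combination of the scaled inequalities. *)
have kE : gamma / theta = 2 * (gamma / (2 * theta)) by field; exact: lt0r_neq0.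
rewrite (_ : gamma ^+ 2 / theta = gamma * (gamma / theta)); last by rewrite mulrA.
rewrite kE hB.
move: hdesc; move: (gamma / (2 * theta)) => k; lra.
Qed.

(** * Expected compression errors *)

Section Compression.
Variables (eta om omav : R).
Hypotheses (eta_ge0 : 0 <= eta) (lam01 : 0 < lam <= 1) (nu01 : 0 < nu <= 1).
Hypothesis C_class : forall t i, in_class P eta om (C t i).
Hypothesis C_av : forall t, omega_av_cond P omav (C t).

Lemma integrable_compressor t i v j : P.-integrable setT (fun w => (C t i w v 0 j)%:E).
Proof. by have [] := C_class t i v. Qed.

Lemma local_shift_err_le t i v :
  P.-integrable setT (EFin \o (fun w => sqnorm (v - lam *: C t i w v))) /\
  \int[P]_w sqnorm (v - lam *: C t i w v) <= r_const lam eta om * sqnorm v.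
Proof.
have [iC [bC vC]] := C_class t i v; split; first exact: integrable_sqnorm_affine iC _ vC _ _.
apply: le_trans (bias_variance_le P iC vC v lam) _.
rewrite /r_const mulrDl mulrA lerD2r.
exact: sqnorm_bias.
Qed.

Lemma integrable_avg_compressor t (v : 'I_n -> 'rV[R]_dim) j :
  P.-integrable setT (fun w => ((n%:R^-1 *: \sum_i C t i w (v i)) 0 j)%:E).
Proof.
under eq_fun do rewrite mxE summxE mulr_sumr.
apply: (integrable_lincomb P (fun=> n%:R^-1) (fun i w => C t i w (v i) 0 j)) => i.
exact: integrable_compressor.
Qed.

(** Bias and variance are averaged differently: Jensen reduces the bias to the individual workers,
    while [omega_av_cond] bounds the variance of the average directly by [omav]. *)
Lemma avg_estimator_err_le t (v : 'I_n -> 'rV[R]_dim) :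
  let err w := sqnorm (n%:R^-1 *: \sum_i v i - nu *: (n%:R^-1 *: \sum_i C t i w (v i))) in
  P.-integrable setT (EFin \o err) /\
  \int[P]_w err w <= r_const nu eta omav * (n%:R^-1 * \sum_i sqnorm (v i)).
Proof.
move=> err; have iC := integrable_avg_compressor t v.
have EC : Evec P (fun w => n%:R^-1 *: \sum_i C t i w (v i))
    = n%:R^-1 *: \sum_i Evec P (fun w => C t i w (v i)).
  by apply: Evec_lincomb => i j; exact: integrable_compressor.
have vC : (\int[P]_w (sqnorm (n%:R^-1 *: \sum_i C t i w (v i)
      - Evec P (fun w => n%:R^-1 *: \sum_i C t i w (v i))))%:E
    <= ((omav / n%:R) * \sum_i sqnorm (v i))%:E)%E.
  rewrite EC; under eq_integral do rewrite -scalerBr -sumrB.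
  exact: C_av.
split; first exact: integrable_sqnorm_affine iC _ vC _ _.
apply: le_trans (bias_variance_le P iC vC _ nu) _.
rewrite /r_const mulrDl !mulrA lerD2r EC.
rewrite scalerA mulrC -scalerA -scalerBr scaler_sumr -sumrB.
apply: le_trans (sqnorm_avg_le _ n_gt0) _.
rewrite -mulrA mulrCA ler_wpM2l ?invr_ge0 // mulr_sumr.
apply: ler_sum => i _; apply: sqnorm_bias => //.
by have [_ []] := C_class t i (v i).
Qed.

Lemma Psi_majorant_expectation t S :
  P.-integrable setT (EFin \o Psi_majorant t S) /\
  \int[P]_w Psi_majorant t S w <=
    (1 - gamma * mu) * (favg f (st_x S) - fstar)
    + gamma / (2 * theta)
      * (theta * r_const nu eta omav + (1 + s) * r_const lam eta om)
      * (n%:R^-1 * \sum_i sqnorm (shift_err S i)).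
Proof.
rewrite /Psi_majorant; move: (shift_err S) => v.
have [iB hB] := avg_estimator_err_le t v.
have iA : P.-integrable setT
    (EFin \o (fun w => \sum_i n%:R^-1 * sqnorm (v i - lam *: C t i w (v i)))).
  apply: (integrable_lincomb P (fun=> n%:R^-1)
    (fun i w => sqnorm (v i - lam *: C t i w (v i)))) => i.
  by have [] := local_shift_err_le t i (v i).
under eq_fun do rewrite [n%:R^-1 * \sum_i _]mulr_sumr.
have hA : \int[P]_w (\sum_i n%:R^-1 * sqnorm (v i - lam *: C t i w (v i)))
    <= r_const lam eta om * (n%:R^-1 * \sum_i sqnorm (v i)).
  rewrite (Rintegral_lincomb P (fun=> n%:R^-1)
    (fun i w => sqnorm (v i - lam *: C t i w (v i)))) => [|i]; last first.
    by have [] := local_shift_err_le t i (v i).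
  rewrite mulrCA mulr_sumr -mulr_sumr ler_wpM2l ?invr_ge0 //.
  by apply: ler_sum => i _; have [] := local_shift_err_le t i (v i).
move: iA hA iB hB.
set A := fun w => \sum_i n%:R^-1 * sqnorm (v i - lam *: C t i w (v i)).
set B := fun w => sqnorm (n%:R^-1 *: \sum_i v i
                          - nu *: (n%:R^-1 *: \sum_i C t i w (v i))).
move=> iA hA iB hB.
set K := (1 - gamma * mu) * _; set a := gamma / (2 * theta).
have icB : P.-integrable setT (EFin \o (fun w => gamma / 2 * B w)).
  exact: (integrableZl measurableT (gamma / 2) iB).
have icA : P.-integrable setT (EFin \o (fun w => a * (1 + s) * A w)).
  exact: (integrableZl measurableT (a * (1 + s)) iA).
have iK := integrable_probability_cst P K.
have iKB : P.-integrable setT (EFin \o (fun w => K + gamma / 2 * B w)).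
  exact: (@integrableD _ _ _ P setT measurableT _ _ iK icB).
split; first exact: (@integrableD _ _ _ P setT measurableT _ _ iKB icA).
rewrite RintegralD // RintegralD // Rintegral_probability_cst !RintegralZl //.
have a0 : 0 <= a by rewrite divr_ge0 ?mulr_ge0 ?ltW.
have as0 : 0 <= a * (1 + s) by rewrite mulr_ge0 // addr_ge0 // ltW.
(* The estimator error thus weighs [theta] times the common factor [a], which produces the term
   [theta * r_const nu eta omav]. *)
have gE : gamma / 2 = a * theta by rewrite /a; field; exact: lt0r_neq0.
have at0 : 0 <= a * theta by rewrite mulr_ge0 // ltW.
rewrite gE; move: (ler_wpM2l as0 hA) (ler_wpM2l at0 hB); lra.
Qed.

End Compression.
End Step.
End Algorithm.

(** * Assembly of the linear convergence rate *)

Theorem theorem1 (R : realType) (n dim : nat)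
  (f : 'I_n -> 'rV[R]_dim -> R) (Ls : 'I_n -> R) (L : R)
  (dd : measure_display) (Omega : measurableType dd) (P : probability Omega R)
  (C : nat -> 'I_n -> Omega -> 'rV[R]_dim -> 'rV[R]_dim)
  (eta om omav mu lam nu gamma : R)
  (x0 : 'rV[R]_dim) (h0 : 'I_n -> 'rV[R]_dim) (xstar : 'rV[R]_dim) :
  (0 < n)%N ->
  (* problem setting *)
  (forall i, convex_fun (f i)) ->
  (forall i, 0 <= Ls i) ->
  (forall i, smooth (f i) (Ls i)) ->
  smooth (favg f) L ->
  L <= Num.sqrt ((n%:R)^-1 * \sum_(i < n) Ls i ^+ 2) ->
  (* compressors *)
  0 <= eta < 1 -> 0 <= om -> 0 <= omav <= om ->
  (forall t i, in_class P eta om (C t i)) ->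
  (forall t, omega_av_cond P omav (C t)) ->
  (* minimizer and PL condition *)
  (forall x, favg f xstar <= favg f x) ->
  0 < mu ->
  (forall x, sqnorm (grad (favg f) x) >= 2 * mu * (favg f x - favg f xstar)) ->
  (* parameters *)
  0 < nu <= 1 -> 0 < lam <= 1 ->
  0 < r_const lam eta om -> r_const lam eta om < 1 ->
  0 < r_const nu eta omav ->
  0 < gamma ->
  gamma <= (L + Num.sqrt ((n%:R)^-1 * \sum_(i < n) Ls i ^+ 2)
              * Num.sqrt (r_const nu eta omav / r_const lam eta om)
              * (s_star (r_const lam eta om))^-1)^-1 ->
  forall t : nat,
    let r := r_const lam eta om in
    let rav := r_const nu eta omav in
    let S0 := State x0 h0 ((n%:R)^-1 *: \sum_(i < n) h0 i) in
    let Psi' := Psi f (favg f xstar) gamma (theta_star r rav) in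
    (Erun P f C gamma lam nu 0 t (fun S => (Psi' S)%:E) S0
      <= ((Num.max (1 - gamma * mu) ((r + 1) / 2)) ^+ t * Psi' S0)%:E)%E.
Proof.
move=> n0 _ _ fs fL _ /andP[eta0 _] _ _ hC hCav hmin mu0 hPL nu01 lam01 r0 r1 rav0 g0 hg t.
cbv zeta; set r := r_const lam eta om; set rav := r_const nu eta omav.
have s0 := s_star_gt0 r0 r1.
have th0 : 0 < theta_star r rav := theta_star_gt0 r0 r1 rav0.
set rho := Num.max _ _.
have rho0 : 0 <= rho.
  have : 0 <= (r + 1) / 2 by move: (r0 : 0 < r); lra.
  by rewrite le_max orbC => ->.
(* The initial averaged shift is the average by construction, so consistency of the initial state is
   immediate. *)
apply: Erun_contraction => // [S|t' S hS]; first exact: Psi_ge0.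
have M0 : 0 <= n%:R^-1 * \sum_i Ls i ^+ 2.
  by rewrite mulr_ge0 ?invr_ge0 //; apply: sumr_ge0 => i _; exact: sqr_ge0.
exists (Psi_majorant f C gamma lam nu mu (favg f xstar) (s_star r) (theta_star r rav) t' S).
have [iU hU] := Psi_majorant_expectation f P C gamma lam nu mu (favg f xstar) (s_star r)
  (theta_star r rav) n0 g0 s0 th0 eta om omav eta0 lam01 nu01 hC hCav t' S.
split => // [w|].
  apply: (Psi_step_le f C gamma lam nu Ls L mu _ _ _ fs fL hPL g0 s0 th0) hS => L0.
  exact: (stepsize_cond r0 r1 rav0 M0 L0 g0 hg).
apply: le_trans hU _.
(* The coefficient of the shift errors becomes [(1 + r) / 2]. The function gap and the shift errors
   are then compared separately, each with its own argument of the maximum. *)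
rewrite theta_star_eq // [rho * _]mulrDr lerD //.
  by rewrite ler_wpM2r ?subr_ge0 // le_max lexx.
have -> (k G : R) : k * ((1 + r) / 2) * G = (1 + r) / 2 * (k * G) by ring.
rewrite ler_wpM2r //; last by rewrite le_max addrC lexx orbT.
have k0 := ltW (divr_gt0 g0 (mulr_gt0 (ltr0Sn R 1) th0)).
apply: mulr_ge0 => //; apply: mulr_ge0; first by rewrite invr_ge0.
by apply: sumr_ge0 => i _; exact: sqnorm_ge0.
Qed.
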